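(* Let a bipartite graph $G$ with fixed parts $A$ and $B$ be proximinal for a semimetric space $(X,d)$, where $X=V(G)=A\cup B$. Then $G$ is a path-proximinal graph if and only if the equalities $A_0=A$ and $B_0=B$ hold.
   Context: Graphs are simple (no loops, no multiple edges), have a nonempty vertex set $V(G)$ and edge set $E(G)$, and may be infinite. A graph is bipartite with parts $A$ and $B$ if $A,B$ are nonempty, disjoint, $V(G)=A\cup B$, and no edge has both ends in the same part. A semimetric on a nonempty set $X$ is a function $d\colon X\times X\to[0,\infty)$ with $d(x,y)=d(y,x)$ and $d(x,y)=0\Leftrightarrow x=y$ for all $x,y\in X$. A nonempty subset $A$ of $(X,d)$ is proximinal if for every $x\in X$ there is $a_0\in A$ with $d(x,a_0)=\inf\{d(x,a)\colon a\in A\}$. For nonempty $A,B\subseteq X$, $\operatorname{dist}(A,B):=\inf\{d(a,b)\colon a\in A,\ b\in B\}$; $A_0:=\{a\in A\colon d(a,b)=\operatorname{dist}(A,B)\text{ for some }b\in B\}$ and $B_0:=\{b\in B\colon d(a,b)=\operatorname{dist}(A,B)\text{ for some }a\in A\}$. A bipartite graph $G$ with fixed parts $A$ and $B$ is proximinal for a semimetric space $(X,d)$ if $A$ and $B$ are disjoint proximinal subsets of $X$ and, for all $a\in A$, $b\in B$, $\{a,b\}\in E(G)\Leftrightarrow d(a,b)=\operatorname{dist}(A,B)$. A path is a finite graph $P$ whose (distinct) vertices can be numbered $u_0,\dots,u_k$, $k\ge 1$, so that $E(P)=\{\{u_0,u_1\},\dots,\{u_{k-1},u_k\}\}$. For nonempty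 disjoint sets $C,D$, a path $P$ is a be-path of $C$ and $D$ if $V(P)\subseteq C\cup D$ and exactly one edge of $P$ meets both $C$ and $D$. A graph $G$ is a path-bipartite graph of $C,D\subseteq V(G)$ if $G$ is the union (of vertex sets and of edge sets) of a nonempty set of be-paths of $C$ and $D$. A graph $G$ is path-proximinal if there are a semimetric $\rho$ on $V(G)$ and disjoint nonempty $C,D\subseteq V(G)$ (not necessarily related to $d$, $A$, $B$) such that $G$ is a path-bipartite graph of $C$ and $D$ (so $V(G)=C\cup D$), $C$ and $D$ are proximinal subsets of $(V(G),\rho)$, and, for all distinct $x,y\in V(G)$, $\{x,y\}\in E(G)\Leftrightarrow\rho(x,y)\le\inf\{\rho(u,v)\colon u\in C,\ v\in D\}$. *)

(* Defs.v *)
From mathcomp Require Import all_boot all_order all_algebra.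
From mathcomp Require Import boolp classical_sets reals.

Set Implicit Arguments.
Unset Strict Implicit.
Unset Printing Implicit Defensive.

Import Order.TTheory GRing.Theory Num.Theory.
Local Open Scope classical_set_scope.
Local Open Scope ring_scope.

(* Simple graphs, possibly infinite, with vertices in an ambient type T. An
   edge is the two-element set of its ends; the vertex set is a subset of T so
   that subgraphs and unions of graphs live in the same type. *)
Record graph (T : Type) := Graph {
  vertices : set T;
  edges : set (set T);
  vertices_neq0 : vertices !=set0;
  edgesP : forall e, edges e -> exists x y : T,
    [/\ vertices x, vertices y, x <> y & e = [set x; y]]
}.

Definition bipartite (T : Type) (G : graph T) (A B : set T) : Prop :=
  [/\ A !=set0, B !=set0, A `&` B = set0, vertices G = A `|` B &
      forall e, edges G e -> ~ (e `<=` A) /\ ~ (e `<=` B)].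

(* The function d is total on T; its values off the carrier X are irrelevant. *)
Definition semimetric (R : realType) (T : Type) (X : set T) (d : T -> T -> R)
    : Prop :=
  X !=set0 /\
  forall x y, X x -> X y ->
    [/\ 0 <= d x y, d x y = d y x & (d x y = 0 <-> x = y)].

Definition proximinal (R : realType) (T : Type) (X : set T) (d : T -> T -> R)
    (A : set T) : Prop :=
  [/\ A `<=` X, A !=set0 &
      forall x, X x -> exists2 a0, A a0 & d x a0 = inf [set d x a | a in A]].

Definition dist (R : realType) (T : Type) (d : T -> T -> R) (A B : set T) : R :=
  inf [set d a b | a in A & b in B].

(* A_0 and B_0 *)
Definition best_left (R : realType) (T : Type) (d : T -> T -> R) (A B : set T)
    : set T :=
  [set a | A a /\ exists2 b, B b & d a b = dist d A B].

Definition best_right (R : realType) (T : Type) (d : T -> T -> R) (A B : set T)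
    : set T :=
  [set b | B b /\ exists2 a, A a & d a b = dist d A B].

(* Disjointness of A and B is part of [bipartite]. *)
Definition proximinal_for (R : realType) (T : Type) (G : graph T)
    (A B X : set T) (d : T -> T -> R) : Prop :=
  [/\ bipartite G A B, proximinal X d A, proximinal X d B &
      forall a b, A a -> B b -> edges G [set a; b] <-> d a b = dist d A B].

(* The path u_0, ..., u_k; only the values u i for i <= k matter. *)
Definition is_path (T : Type) (P : graph T) : Prop :=
  exists (k : nat) (u : nat -> T),
    [/\ (1 <= k)%N,
        forall i j, (i <= k)%N -> (j <= k)%N -> u i = u j -> i = j,
        vertices P = [set u i | i in [set i | (i <= k)%N]] &
        edges P = [set [set u i; u i.+1] | i in [set i | (i < k)%N]]].

Definition be_path (T : Type) (C D : set T) (P : graph T) : Prop :=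
  [/\ is_path P, vertices P `<=` C `|` D &
      exists! e, [/\ edges P e, e `&` C !=set0 & e `&` D !=set0]].

Definition path_bipartite (T : Type) (G : graph T) (C D : set T) : Prop :=
  [/\ C !=set0, D !=set0, C `&` D = set0,
      C `<=` vertices G /\ D `<=` vertices G &
      exists F : set (graph T),
        [/\ F !=set0, forall P, F P -> be_path C D P,
            vertices G = \bigcup_(P in F) vertices P &
            edges G = \bigcup_(P in F) edges P]].

Definition path_proximinal (R : realType) (T : Type) (G : graph T) : Prop :=
  exists (rho : T -> T -> R) (C D : set T),
    [/\ semimetric (vertices G) rho, path_bipartite G C D,
        proximinal (vertices G) rho C, proximinal (vertices G) rho D &
        forall x y, vertices G x -> vertices G y -> x <> y ->
          edges G [set x; y] <-> rho x y <= dist rho C D].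
Arguments path_proximinal R [T] G.

(* Main.v *)
Require Import Defs.
From mathcomp Require Import all_boot all_order all_algebra.
From mathcomp Require Import boolp classical_sets reals.

(** Both conditions say that [G] has no isolated vertex. A vertex of a path has
    a neighbour, which gives one direction. Conversely, if no vertex is isolated
    then [G] is the union of its edges, each of which is a be-path of [A] and
    [B], and the semimetric with values 0 on the diagonal, 1 on edges and 2
    elsewhere witnesses path-proximinality with [C = A] and [D = B]; the
    original semimetric [d] plays no role there. *)

Set Implicit Arguments.
Unset Strict Implicit.
Unset Printing Implicit Defensive.

Import Order.TTheory GRing.Theory Num.Theory.
Local Open Scope classical_set_scope.
Local Open Scope ring_scope.

Definition no_isolated (T : Type) (G : graph T) : Prop :=
  forall x, vertices G x -> exists2 y, vertices G y & edges G [set x; y].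

(** Every infimum computed below is attained. The minimiser also shows that the set is nonempty and
    bounded below, as the bounds on [inf] require. *)
Lemma inf_min (R : realType) (S : set R) (m : R) :
  S m -> lbound S m -> inf S = m.
Proof.
move=> Sm lbm; apply/eqP; rewrite eq_le; apply/andP; split.
  by apply: ge_inf => //; exists m.
by apply: lb_le_inf => //; exists m.
Qed.

Lemma bipartite_sym (T : Type) (G : graph T) (A B : set T) :
  bipartite G A B -> bipartite G B A.
Proof.
case=> A0 B0 AB VG eG; split => //; rewrite 1?setIC 1?setUC //.
by move=> e /eG[].
Qed.

Lemma bipartite_neighbour (T : Type) (G : graph T) (A B : set T) (x y : T) :
  bipartite G A B -> A x -> vertices G y -> edges G [set x; y] -> B y.
Proof.
case=> _ _ _ -> eG Ax [Ay|//] /eG[nA _].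
by exfalso; apply: nA => _ [->|->].
Qed.

Lemma bipartite_neq (T : Type) (G : graph T) (A B : set T) (x y : T) :
  bipartite G A B -> A x -> B y -> x <> y.
Proof.
case=> _ _ AB _ _ Ax By xy.
by have: (A `&` B) y; [split=> //; rewrite -xy | rewrite AB].
Qed.

(** [edgesP] lists the two ends in an unknown order. If the first one lies in [B], its neighbour
    lies in [A] and the ends are swapped. *)
Lemma bipartite_edge (T : Type) (G : graph T) (A B : set T) (e : set T) :
  bipartite G A B -> edges G e ->
  exists a b, [/\ A a, B b & e = [set a; b]].
Proof.
move=> GAB Ge; have [x [y [Vx Vy _ exy]]] := edgesP Ge.
rewrite exy in Ge *; have [_ _ _ VG _] := GAB.
move: (Vx); rewrite VG => -[Ax|Bx].
  by exists x, y; split=> //; apply: bipartite_neighbour GAB Ax Vy Ge.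
exists y, x; split=> //; last exact: setUC.
exact: bipartite_neighbour (bipartite_sym GAB) Bx Vy Ge.
Qed.

(** Since [1 <= k], the vertex [u 0] is adjacent to [u 1]; every later vertex is adjacent to its
    predecessor, so the last one needs no separate case. *)
Lemma path_no_isolated (T : Type) (P : graph T) : is_path P -> no_isolated P.
Proof.
case=> k [u [k1 _ VP EP]] x; rewrite VP EP => -[[|i] ik <-].
  by exists (u 1%N); [exists 1%N | exists 0%N].
by exists (u i); [exists i; first exact: ltnW | exists i; last exact: setUC].
Qed.

Lemma path_bipartite_no_isolated (T : Type) (G : graph T) (C D : set T) :
  path_bipartite G C D -> no_isolated G.
Proof.
case=> _ _ _ _ [F [_ FP VG EG]] x; rewrite VG EG => -[P FP_P Px].
have [pP _ _] := FP P FP_P; have [y Py Pxy] := path_no_isolated pP Px.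
by exists y; exists P.
Qed.

Lemma edge_graph_edgesP (T : Type) (x y : T) : x <> y ->
  forall e, [set [set x; y]] e -> exists x' y' : T,
    [/\ [set x; y] x', [set x; y] y', x' <> y' & e = [set x'; y']].
Proof. by move=> xy e ->; exists x, y; split=> //; [left|right]. Qed.

(** The path of length 1. The proof [xy] is an argument because [graph] excludes loops. *)
Definition edge_graph (T : Type) (x y : T) (xy : x <> y) : graph T :=
  Graph (ex_intro _ x (or_introl erefl) : [set x; y] !=set0)
    (edge_graph_edgesP xy).

Lemma edge_graph_be_path (T : Type) (C D : set T) (x y : T) (xy : x <> y) :
  C x -> D y -> be_path C D (edge_graph xy).
Proof.
move=> Cx Dy; split.
(* The numbering sends 0 to [x] and 1 to [y]; its values beyond 1 do not matter. *)
- exists 1%N, (fun i => if i is 0%N then x else y); split => //=.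
  + by move=> [|[|i]] [|[|j]] // _ _ /esym.
  + apply/seteqP; split=> z /=.
      by case=> ->; [exists 0%N | exists 1%N].
    by case=> -[|[|i]] // _ <-; [left | right].
  + apply/seteqP; split=> e /=; first by move=> ->; exists 0%N.
    by case=> -[|i] // _ <-.
- by move=> _ [->|->]; [left | right].
- exists [set x; y]; split=> [|e [->]] //.
  by split=> //; [exists x; split=> //; left | exists y; split=> //; right].
Qed.

Lemma bipartite_path_bipartite (T : Type) (G : graph T) (A B : set T) :
  bipartite G A B -> no_isolated G -> path_bipartite G A B.
Proof.
move=> GAB Gni; have [A0 B0 AB VG _] := GAB.
have neqAB x y := @bipartite_neq _ _ _ _ x y GAB.
(* One path per edge of [G], oriented from [A] to [B]; every edge crosses between the parts, so each
   of these is a be-path. *)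
pose F := [set P : graph T | exists x y (xy : x <> y),
  [/\ A x, B y, edges G [set x; y] & P = edge_graph xy]].
have Fedge a b : A a -> B b -> edges G [set a; b] ->
    exists P, [/\ F P, vertices P = [set a; b] & edges P = [set [set a; b]]].
  move=> Aa Bb Gab; exists (edge_graph (neqAB _ _ Aa Bb)); split=> //.
  by exists a, b, (neqAB _ _ Aa Bb).
have Fcover e : edges G e -> exists P, [/\ F P, vertices P = e & edges P e].
  move=> Ge; have [a [b [Aa Bb eab]]] := bipartite_edge GAB Ge.
  rewrite eab in Ge *; have [P [FP VP EP]] := Fedge _ _ Aa Bb Ge.
  by exists P; rewrite EP.
split=> //; first by rewrite VG; split=> x; [left | right].
exists F; split.
- have [x Ax] := A0; have Vx : vertices G x by rewrite VG; left.
  have [y _ /Fcover[P [FP _ _]]] := Gni _ Vx.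
  by exists P.
- by move=> P [x [y [xy [Ax By _ ->]]]]; apply: edge_graph_be_path.
(* Covering the vertices is where [Gni] enters: each vertex lies on some edge, hence on a path of
   [F]. *)
- apply/seteqP; split=> [x /Gni[y _ /Fcover[P [FP VP _]]]|x].
    by exists P => //; rewrite VP; left.
  case=> P [a [b [ab [Aa Bb _ ->]]]] /= [->|->]; rewrite VG; first by left.
  by right.
- apply/seteqP; split=> [e /Fcover[P [FP _ Pe]]|e]; first by exists P.
  by case=> P [a [b [ab [Aa Bb Gab ->]]]] /= ->.
Qed.

(** Equality and adjacency are decided classically. Among distinct points, the threshold 1 singles
    out the edges; 2 stands for any value above it. *)
Definition edge_semimetric (R : realType) (T : Type) (G : graph T) (x y : T)
    : R :=
  if `[< x = y >] then 0 else if `[< edges G [set x; y] >] then 1 else 2.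

Section edge_semimetric.
Variables (R : realType) (T : Type) (G : graph T).
Local Notation rho := (@edge_semimetric R T G).

Lemma edge_semimetric_ge0 x y : 0 <= rho x y.
Proof. by rewrite /edge_semimetric; do 2?case: asboolP. Qed.

Lemma edge_semimetricxx x : rho x x = 0.
Proof. by rewrite /edge_semimetric; case: asboolP. Qed.

Lemma edge_semimetric_sym x y : rho x y = rho y x.
Proof.
have [->//|xy] := pselect (x = y).
rewrite /edge_semimetric (setUC [set x]).
by case: (asboolP (x = y)) => // _; case: (asboolP (y = x)) => // /esym.
Qed.

Lemma edge_semimetric_eq0 x y : rho x y = 0 -> x = y.
Proof.
rewrite /edge_semimetric; case: asboolP => // _.
by case: asboolP => _ /eqP; rewrite ?oner_eq0 ?pnatr_eq0.
Qed.

Lemma edge_semimetric_ge1 x y : x <> y -> 1 <= rho x y.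
Proof.
rewrite /edge_semimetric => xy; case: asboolP => // _.
by case: asboolP => _ //; rewrite ler1n.
Qed.

Lemma edge_semimetric_le1 x y :
  x <> y -> rho x y <= 1 <-> edges G [set x; y].
Proof.
rewrite /edge_semimetric => xy; case: asboolP => // _.
by case: asboolP => e; split=> //; rewrite lern1.
Qed.

Lemma edge_semimetric_edge x y :
  x <> y -> edges G [set x; y] -> rho x y = 1.
Proof. by rewrite /edge_semimetric; do 2?case: asboolP. Qed.

End edge_semimetric.

Lemma edge_semimetricP (R : realType) (T : Type) (G : graph T) :
  semimetric (vertices G) (@edge_semimetric R T G).
Proof.
split=> [|x y _ _]; first exact: vertices_neq0.
split; [exact: edge_semimetric_ge0 | exact: edge_semimetric_sym |].
split=> [|->]; [exact: edge_semimetric_eq0 | exact: edge_semimetricxx].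
Qed.

(** A point of [A] is its own nearest point, at distance 0. A point of [B] has a neighbour in [A] at
    distance 1, and distinct points are never closer. *)
Lemma edge_semimetric_proximinal (R : realType) (T : Type) (G : graph T)
    (A B : set T) :
  bipartite G A B -> no_isolated G ->
  proximinal (vertices G) (@edge_semimetric R T G) A.
Proof.
move=> GAB Gni; have [A0 _ _ VG _] := GAB.
split=> // [x Ax|x Vx]; first by rewrite VG; left.
move: (Vx); rewrite VG => -[Ax|Bx].
  exists x => //; apply/esym/inf_min; first by exists x.
  by move=> _ [a _ <-]; rewrite edge_semimetricxx edge_semimetric_ge0.
have neq a : A a -> x <> a := bipartite_neq (bipartite_sym GAB) Bx.
have [y Vy Gxy] := Gni _ Vx.
have Ay := bipartite_neighbour (bipartite_sym GAB) Bx Vy Gxy.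
exists y => //; apply/esym/inf_min; first by exists y.
move=> _ [a Aa <-]; rewrite (edge_semimetric_edge R (neq _ Ay) Gxy).
exact: edge_semimetric_ge1 (neq _ Aa).
Qed.

(** Any edge at a vertex of [A] attains the least possible distance 1 between distinct points. *)
Lemma edge_semimetric_dist (R : realType) (T : Type) (G : graph T)
    (A B : set T) :
  bipartite G A B -> no_isolated G -> dist (@edge_semimetric R T G) A B = 1.
Proof.
move=> GAB Gni; have [[x Ax] _ _ VG _] := GAB.
have Vx : vertices G x by rewrite VG; left.
have [y Vy Gxy] := Gni _ Vx.
have By := bipartite_neighbour GAB Ax Vy Gxy.
apply: inf_min.
  exists x => //; exists y => //.
  by apply: edge_semimetric_edge => //; exact: bipartite_neq GAB _ _.
move=> _ [a Aa [b Bb <-]].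
by apply: edge_semimetric_ge1; exact: bipartite_neq GAB _ _.
Qed.

Lemma bipartite_path_proximinal (R : realType) (T : Type) (G : graph T)
    (A B : set T) :
  bipartite G A B -> path_proximinal R G <-> no_isolated G.
Proof.
move=> GAB; split=> [[rho [C [D [_ GCD _ _ _]]]]|Gni].
  exact: path_bipartite_no_isolated GCD.
exists (@edge_semimetric R T G), A, B; split.
- exact: edge_semimetricP.
- exact: bipartite_path_bipartite.
- exact: edge_semimetric_proximinal GAB Gni.
- exact: edge_semimetric_proximinal (bipartite_sym GAB) Gni.
- move=> x y _ _ xy; rewrite (edge_semimetric_dist R GAB Gni).
  by apply: iff_sym; exact: edge_semimetric_le1.
Qed.

Theorem proposition3p8 (R : realType) (T : Type) (G : graph T)
    (A B X : set T) (d : T -> T -> R)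
    (hd : semimetric X d) (hX : X = vertices G)
    (hG : proximinal_for G A B X d) :
  path_proximinal R G <-> best_left d A B = A /\ best_right d A B = B.
Proof.
have [GAB _ _ edgeP] := hG; have [_ _ _ VG _] := GAB.
(* What remains is a statement about [d]: by [edgeP], a neighbour of a point is exactly a point of
   the other part at distance [dist d A B] from it. *)
rewrite (bipartite_path_proximinal R GAB); split=> [Gni|[AE BE] x].
  split; apply/seteqP; split=> x; try by case.
    move=> Ax; have Vx : vertices G x by rewrite VG; left.
    have [y Vy Gxy] := Gni _ Vx.
    have By := bipartite_neighbour GAB Ax Vy Gxy.
    by split=> //; exists y => //; apply/edgeP.
  move=> Bx; have Vx : vertices G x by rewrite VG; right.
  have [y Vy Gxy] := Gni _ Vx.
  have Ay := bipartite_neighbour (bipartite_sym GAB) Bx Vy Gxy.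
  (* [edgeP] expects the end in [A] first, so an edge at a point of [B] is reversed. *)
  by split=> //; exists y => //; apply/edgeP => //; rewrite setUC.
rewrite VG => -[Ax|Bx].
  move: (Ax); rewrite -AE => -[_ [y By dxy]].
  by exists y; [right | apply/edgeP].
move: (Bx); rewrite -BE => -[_ [y Ay dyx]].
by exists y; [left | rewrite setUC; apply/edgeP].
Qed.
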